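(* Let $\varphi:\mathbb{N}\to\mathbb{R}$ be finitely supported, and set $\varphi(0)=0$. Then $$\sum_{n=1}^{\infty} \big( \varphi(n) -\varphi(n-1) \big)^2 \geq \sum_{n=1}^{\infty} w(n)\,\varphi(n)^2,$$ where $w$ is the strictly positive function on $\mathbb{N}$ given by $w(1)=2-\sqrt{2}$ and, for $n\ge 2$, $$w(n)= \sum_{k=1}^{\infty} \binom{4k}{2k} \frac{1}{(4k-1)2^{4k-1}} \frac{1}{n^{2k}} = \frac{1}{4n^2} + \frac{5}{64n^4} + \frac{21}{512n^6} +\ldots .$$ In particular, $w(n)$ is strictly greater than the classical Hardy weight $w_H(n):=1/(2n)^2$ for every $n\in\mathbb{N}$.
   Context: $\mathbb{N}=\{1,2,3,\ldots\}$. *)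

(* Defs.v *)
From Stdlib Require Import Reals List.
From Coquelicot Require Import Coquelicot.

Open Scope R_scope.

(* The positive integers are the n : nat with n >= 1; series over them are
   Coquelicot series with the index shifted by one. *)
Definition is_series1 (a : nat -> R) (l : R) : Prop :=
  is_series (fun j : nat => a (S j)) l.

Definition ex_series1 (a : nat -> R) : Prop :=
  ex_series (fun j : nat => a (S j)).

Definition Series1 (a : nat -> R) : R :=
  Series (fun j : nat => a (S j)).

Definition finitely_supported (phi : nat -> R) : Prop :=
  exists l : list nat, forall n : nat, phi n <> 0 -> In n l.

(* [Binomial.C] is the binomial coefficient; the bare name [C] is Coquelicot's
   type of complex numbers. *)
Definition hardy_term (n k : nat) : R :=
  Binomial.C (4 * k) (2 * k)
  * (1 / ((4 * INR k - 1) * 2 ^ (4 * k - 1)))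
  * (1 / INR n ^ (2 * k)).

(* Only the values at n >= 1 are meaningful. *)
Definition w (n : nat) : R :=
  match n with
  | 1%nat => 2 - sqrt 2
  | _ => Series1 (hardy_term n)
  end.

Definition w_H (n : nat) : R := 1 / (2 * INR n) ^ 2.

(* Main.v *)
Require Import Defs.
From Stdlib Require Import Reals List.
From Coquelicot Require Import Coquelicot.
From Stdlib Require Import Lra Lia.

Open Scope R_scope.

(** The weight has the closed form [2 - sqrt (1 + 1/n) - sqrt (1 - 1/n)]
    ([w_closed_form]), that is, [(2 u(n) - u(n+1) - u(n-1)) / u(n)] for
    [u(n) = sqrt n]: it is the discrete Laplacian of a positive function divided
    by that function.  Everything follows from this.

    The closed form is the even part of the binomial series of [sqrt (1 - x)].
    The sum of that series solves [2 (1 - x) f' = - f], because its coefficients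
    satisfy a two-term recurrence; so does [sqrt (1 - x)], and the quotient of
    the two is therefore constant ([PSeries_sqrt_coef]).  Adding the values at
    [x] and [-x] cancels the odd terms.  At [n = 1] the closed form is just
    [2 - sqrt 2 - sqrt 0].

    The inequality is a ground state argument.  With [r = u(n)/u(n+1)],
    [(a - b)^2 >= a^2 (1 - r) + b^2 (1 - 1/r)] since the difference of the two
    sides is [(a r - b)^2 / r].  Summing this over [n] with [a = phi(n+1)] and
    [b = phi(n)] collects the coefficient [w(n)] in front of [phi(n)^2], up to a
    boundary term of the right sign ([hardy_partial_sums]).

    Finally [s = sqrt (1 + x) + sqrt (1 - x)] satisfies
    [s^2 = 2 + 2 sqrt (1 - x^2) <= 4 - x^2 < (2 - x^2/4)^2]; at [x = 1/n] this is
    the comparison with the classical weight. *)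

(** * The binomial series of sqrt (1 - x) *)

Definition sqrt_coef (m : nat) : R :=
  Binomial.C (2 * m) m / (4 ^ m * (1 - 2 * INR m)).

Lemma one_sub_double_neq0 (m : nat) : 1 - 2 * INR m <> 0.
Proof.
  (* The case m = 0 is the only one where the expression is positive. *)
  destruct m as [|m].
  - simpl; lra.
  - rewrite S_INR; pose proof (pos_INR m); lra.
Qed.

Lemma central_binomial_succ (m : nat) :
  Binomial.C (2 * S m) (S m) * (INR m + 1)
  = Binomial.C (2 * m) m * (2 * (2 * INR m + 1)).
Proof.
  unfold Binomial.C.
  replace (2 * S m - S m)%nat with (S m) by lia.
  replace (2 * m - m)%nat with m by lia.
  replace (2 * S m)%nat with (S (S (2 * m))) by lia.
  rewrite !fact_simpl, !mult_INR, !S_INR, mult_INR.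
  pose proof (INR_fact_neq_0 m); pose proof (pos_INR m).
  change (INR 2) with 2.
  field; split; lra.
Qed.

Lemma sqrt_coef_succ (m : nat) :
  sqrt_coef (S m) * (2 * (INR m + 1)) = sqrt_coef m * (2 * INR m - 1).
Proof.
  pose proof (central_binomial_succ m) as HC.
  pose proof (one_sub_double_neq0 m) as Hm.
  pose proof (one_sub_double_neq0 (S m)) as HSm.
  pose proof (pow_nonzero 4 m ltac:(lra)) as H4.
  pose proof (pos_INR m).
  unfold sqrt_coef.
  rewrite S_INR in *; simpl pow.
  replace (Binomial.C (2 * S m) (S m))
    with (Binomial.C (2 * m) m * (2 * (2 * INR m + 1)) / (INR m + 1))
    by (rewrite <- HC; field; lra).
  field; repeat split; lra.
Qed.

Lemma sqrt_coef_0 : sqrt_coef 0 = 1.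
Proof. unfold sqrt_coef, Binomial.C; simpl; field. Qed.

(** The recurrence is the practical way to these values: the factorials in
    [Binomial.C 12 6] are too large to expand as real numbers. *)
Lemma sqrt_coef_2_4_6 :
  sqrt_coef (2 * 1) = - 1 / 8 /\
  sqrt_coef (2 * 2) = - 5 / 128 /\
  sqrt_coef (2 * 3) = - 21 / 1024.
Proof.
  pose proof sqrt_coef_0 as H0.
  pose proof (sqrt_coef_succ 0) as H1; pose proof (sqrt_coef_succ 1) as H2.
  pose proof (sqrt_coef_succ 2) as H3; pose proof (sqrt_coef_succ 3) as H4.
  pose proof (sqrt_coef_succ 4) as H5; pose proof (sqrt_coef_succ 5) as H6.
  simpl in *; lra.
Qed.

Lemma sqrt_coef_bound (m : nat) : Rabs (sqrt_coef m) <= 1.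
Proof.
  induction m as [|m IH].
  - rewrite sqrt_coef_0, Rabs_R1; lra.
  - pose proof (sqrt_coef_succ m) as H; pose proof (pos_INR m).
    replace (sqrt_coef (S m))
      with (sqrt_coef m * ((2 * INR m - 1) / (2 * (INR m + 1))))
      by (field_simplify_eq; [lra | lra]).
    rewrite Rabs_mult, <- (Rmult_1_l 1).
    apply Rmult_le_compat; try apply Rabs_pos; [exact IH|].
    apply Rabs_le; split.
    + apply Rle_div_r; lra.
    + apply Rle_div_l; lra.
Qed.

Lemma CV_radius_gt_of_bounded (a : nat -> R) (x : R) :
  (forall n, Rabs (a n) <= 1) -> Rabs x < 1 -> Rbar_lt (Rabs x) (CV_radius a).
Proof.
  intros Ha Hx.
  apply Rbar_lt_le_trans with 1; [exact Hx|].
  apply (CV_radius_bounded a).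
  exists 1; intros n; rewrite pow1, Rmult_1_r; apply Ha.
Qed.

(** The recurrence [sqrt_coef_succ], read coefficientwise, is the differential
    equation that characterises [sqrt (1 - x)] up to a factor. *)
Lemma PSeries_sqrt_coef_ode (x : R) :
  Rabs x < 1 ->
  2 * (1 - x) * PSeries (PS_derive sqrt_coef) x = - PSeries sqrt_coef x.
Proof.
  intros Hx.
  pose proof (CV_radius_gt_of_bounded _ x sqrt_coef_bound Hx) as HR.
  assert (Hf : ex_pseries sqrt_coef x) by (apply CV_radius_inside, HR).
  assert (Hd : ex_pseries (PS_derive sqrt_coef) x)
    by (apply CV_radius_inside; rewrite CV_radius_derive; exact HR).
  assert (Hi : ex_pseries (PS_incr_1 (PS_derive sqrt_coef)) x)
    by (apply ex_pseries_incr_1, Hd).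
  assert (E : PSeries sqrt_coef x =
              PSeries (PS_plus (PS_scal 2 (PS_incr_1 (PS_derive sqrt_coef)))
                               (PS_scal (-2) (PS_derive sqrt_coef))) x).
  { apply PSeries_ext; intros n.
    pose proof (sqrt_coef_succ n) as H.
    destruct n as [|n].
    - unfold PS_plus, PS_scal, PS_derive, PS_incr_1, plus, scal, zero; simpl.
      unfold mult; simpl in *; lra.
    - change (sqrt_coef (S n) = 2 * (INR (S n) * sqrt_coef (S n))
                                + -2 * (INR (S (S n)) * sqrt_coef (S (S n)))).
      rewrite (S_INR (S n)); lra. }
  rewrite PSeries_plus in E;
    [| apply ex_pseries_scal; [apply Rmult_comm | exact Hi]
     | apply ex_pseries_scal; [apply Rmult_comm | exact Hd]].
  rewrite !PSeries_scal, PSeries_incr_1 in E.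
  lra.
Qed.

Lemma PSeries_sqrt_coef (x : R) :
  Rabs x < 1 -> PSeries sqrt_coef x = sqrt (1 - x).
Proof.
  intros Hx.
  set (q := fun y => PSeries sqrt_coef y / sqrt (1 - y)).
  assert (Hq : forall y, Rabs y < 1 -> is_derive q y 0).
  { intros y Hy.
    pose proof (PSeries_sqrt_coef_ode y Hy) as Hode.
    assert (Hy1 : 0 < 1 - y) by (apply Rabs_lt_between in Hy; lra).
    pose proof (sqrt_lt_R0 _ Hy1) as Hs.
    pose proof (sqrt_sqrt (1 - y) ltac:(lra)) as Hss.
    assert (Hsqrt : is_derive (fun t => sqrt (1 - t)) y (- 1 / (2 * sqrt (1 - y)))).
    { apply (is_derive_sqrt (fun t => 1 - t)); [|exact Hy1].
      auto_derive; [exact I | ring]. }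
    pose proof (is_derive_div _ _ y _ _
      (is_derive_PSeries _ _ (CV_radius_gt_of_bounded _ y sqrt_coef_bound Hy))
      Hsqrt ltac:(lra)) as Hdiv.
    replace 0 with
      ((PSeries (PS_derive sqrt_coef) y * sqrt (1 - y)
        - PSeries sqrt_coef y * (- 1 / (2 * sqrt (1 - y)))) / sqrt (1 - y) ^ 2);
      [exact Hdiv|].
    replace (PSeries sqrt_coef y)
      with (- (2 * (sqrt (1 - y) * sqrt (1 - y))
               * PSeries (PS_derive sqrt_coef) y))
      by (rewrite Hss; lra).
    field; lra. }
  (* Moving along the segment from 0 to x treats both signs of x at once. *)
  assert (E : q (0 * x) = q (1 * x)).
  { apply (eq_is_derive (fun t => q (t * x)) 0 1); [|lra].
    intros t Ht.
    assert (Htx : Rabs (t * x) < 1).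
    { rewrite Rabs_mult, (Rabs_pos_eq t) by lra.
      pose proof (Rabs_pos x); nra. }
    replace (@zero R_NormedModule) with (scal x 0)
      by (unfold scal, zero; simpl; apply Rmult_0_r).
    apply (is_derive_comp q (fun t => t * x)); [exact (Hq _ Htx)|].
    auto_derive; [exact I | ring]. }
  unfold q in E.
  rewrite Rmult_0_l, Rmult_1_l, PSeries_0, sqrt_coef_0, Rminus_0_r, sqrt_1 in E.
  assert (Hs : 0 < sqrt (1 - x))
    by (apply sqrt_lt_R0; apply Rabs_lt_between in Hx; lra).
  apply (Rmult_eq_reg_r (/ sqrt (1 - x))).
  - unfold Rdiv in E; rewrite <- E; field; lra.
  - apply Rinv_neq_0_compat; lra.
Qed.

Lemma even_part_sqrt_series (x : R) :
  Rabs x < 1 ->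
  is_pseries (fun k => 2 * sqrt_coef (2 * k)) (x ^ 2) (sqrt (1 + x) + sqrt (1 - x)).
Proof.
  intros Hx.
  assert (Hx2 : Rabs (x ^ 2) < 1).
  { rewrite <- RPow_abs; pose proof (Rabs_pos x); nra. }
  assert (He : ex_pseries (fun k => sqrt_coef (2 * k)) (x ^ 2)).
  { apply CV_radius_inside, CV_radius_gt_of_bounded; [|exact Hx2].
    intros n; apply sqrt_coef_bound. }
  assert (Ho : ex_pseries (fun k => sqrt_coef (2 * k + 1)) (x ^ 2)).
  { apply CV_radius_inside, CV_radius_gt_of_bounded; [|exact Hx2].
    intros n; apply sqrt_coef_bound. }
  assert (Ep := PSeries_odd_even sqrt_coef x He Ho).
  assert (Em : PSeries sqrt_coef (- x) =
    PSeries (fun k => sqrt_coef (2 * k)) (x ^ 2)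
    + - x * PSeries (fun k => sqrt_coef (2 * k + 1)) (x ^ 2)).
  { replace (x ^ 2) with ((- x) ^ 2) in He, Ho |- * by ring.
    exact (PSeries_odd_even sqrt_coef (- x) He Ho). }
  rewrite PSeries_sqrt_coef in Ep by exact Hx.
  rewrite PSeries_sqrt_coef in Em by (rewrite Rabs_Ropp; exact Hx).
  replace (sqrt (1 + x) + sqrt (1 - x))
    with (scal 2 (PSeries (fun k => sqrt_coef (2 * k)) (x ^ 2))).
  - apply (is_pseries_scal 2 (fun k => sqrt_coef (2 * k))); [apply Rmult_comm|].
    apply PSeries_correct, He.
  - replace (1 + x) with (1 - - x) by ring.
    change (2 * PSeries (fun k => sqrt_coef (2 * k)) (x ^ 2)
            = sqrt (1 - - x) + sqrt (1 - x)).
    lra.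
Qed.

(** * The closed form of the weight *)

Lemma hardy_term_sqrt_coef (n k : nat) :
  (1 <= n)%nat -> (1 <= k)%nat ->
  hardy_term n k = - (2 * sqrt_coef (2 * k) * ((1 / INR n) ^ 2) ^ k).
Proof.
  intros Hn Hk.
  assert (Hn0 : INR n <> 0) by (apply not_0_INR; lia).
  pose proof (one_sub_double_neq0 (2 * k)) as Hd.
  unfold hardy_term, sqrt_coef.
  replace (2 * (2 * k))%nat with (4 * k)%nat by lia.
  replace (4 ^ (2 * k)) with (2 * 2 ^ (4 * k - 1)).
  2:{ replace 4 with (2 ^ 2) by ring.
      rewrite <- pow_mult, tech_pow_Rmult; f_equal; lia. }
  replace (((1 / INR n) ^ 2) ^ k) with (/ INR n ^ (2 * k))
    by (rewrite <- pow_mult, <- pow_inv; f_equal; field; exact Hn0).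
  rewrite mult_INR in *; change (INR 2) with 2 in *.
  pose proof (pow_nonzero 2 (4 * k - 1) ltac:(lra)).
  pose proof (pow_nonzero (INR n) (2 * k) Hn0).
  field; repeat split; lra.
Qed.

Lemma is_series1_hardy_term (n : nat) :
  (2 <= n)%nat ->
  is_series1 (hardy_term n) (2 - sqrt (1 + 1 / INR n) - sqrt (1 - 1 / INR n)).
Proof.
  intros Hn.
  assert (Hn2 : 2 <= INR n) by (apply (le_INR 2); exact Hn).
  assert (Hx : Rabs (1 / INR n) < 1).
  { rewrite Rabs_pos_eq; [apply Rlt_div_l; lra|].
    apply Rle_div_r; lra. }
  pose proof (even_part_sqrt_series _ Hx) as HS.
  set (x := 1 / INR n) in *.
  set (s := sqrt (1 + x) + sqrt (1 - x)) in *.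
  unfold is_series1.
  replace (2 - sqrt (1 + x) - sqrt (1 - x)) with (opp (s - 2))
    by (unfold s, opp; simpl; ring).
  apply is_series_ext with
    (fun j => opp (2 * sqrt_coef (2 * S j) * (x ^ 2) ^ S j)).
  { intros j; symmetry; apply (hardy_term_sqrt_coef n (S j)); lia. }
  apply (is_series_opp (fun j => 2 * sqrt_coef (2 * S j) * (x ^ 2) ^ S j)).
  apply (is_series_incr_1 (fun k => 2 * sqrt_coef (2 * k) * (x ^ 2) ^ k)).
  replace (plus _ _) with s
    by (unfold plus; simpl; rewrite sqrt_coef_0; ring).
  apply is_series_ext with (2 := HS).
  intros k; rewrite pow_n_pow.
  unfold scal; simpl; unfold mult; simpl; ring.
Qed.

Lemma w_closed_form (n : nat) :
  (1 <= n)%nat -> w n = 2 - sqrt (1 + 1 / INR n) - sqrt (1 - 1 / INR n).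
Proof.
  intros Hn.
  destruct n as [|[|n]]; [lia| |].
  - simpl; replace (1 + 1 / 1) with 2 by field.
    replace (1 - 1 / 1) with 0 by field.
    rewrite sqrt_0; ring.
  - apply is_series_unique, is_series1_hardy_term; lia.
Qed.

(** Squaring once leaves [sqrt (1 - x^2) <= 1 - x^2/2]; the [x^4/16] gained on
    completing the square is what makes the inequality strict. *)
Lemma sqrt_sum_lt (x : R) :
  0 < x <= 1 -> sqrt (1 + x) + sqrt (1 - x) < 2 - x ^ 2 / 4.
Proof.
  intros Hx.
  pose proof (sqrt_pos (1 + x)) as Hp; pose proof (sqrt_pos (1 - x)) as Hm.
  pose proof (sqrt_sqrt (1 + x) ltac:(lra)) as Hpp.
  pose proof (sqrt_sqrt (1 - x) ltac:(lra)) as Hmm.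
  set (a := sqrt (1 + x)) in *; set (b := sqrt (1 - x)) in *.
  assert (Hab : a * b <= 1 - x ^ 2 / 2).
  { apply Rsqr_incr_0_var; [|nra].
    unfold Rsqr; replace (a * b * (a * b)) with ((a * a) * (b * b)) by ring.
    rewrite Hpp, Hmm; pose proof (pow2_ge_0 (x ^ 2)); nra. }
  assert (0 < x ^ 2) by (apply pow_lt; lra).
  apply Rsqr_incrst_0; [| lra | nra].
  unfold Rsqr.
  assert (0 < x ^ 2 * x ^ 2) by (apply Rmult_lt_0_compat; lra).
  nra.
Qed.

Lemma w_gt_w_H (n : nat) : (1 <= n)%nat -> w n > w_H n.
Proof.
  intros Hn.
  assert (Hn1 : 1 <= INR n) by (apply (le_INR 1); exact Hn).
  rewrite (w_closed_form n Hn).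
  assert (Hx : 0 < 1 / INR n <= 1).
  { split; [apply Rdiv_lt_0_compat | apply Rle_div_l]; lra. }
  pose proof (sqrt_sum_lt _ Hx).
  unfold w_H.
  replace (1 / (2 * INR n) ^ 2) with ((1 / INR n) ^ 2 / 4) by (field; lra).
  lra.
Qed.

Lemma w_pos (n : nat) : (1 <= n)%nat -> 0 < w n.
Proof.
  intros Hn.
  apply Rlt_trans with (w_H n); [|exact (w_gt_w_H n Hn)].
  assert (0 < INR n) by (apply lt_0_INR; lia).
  apply Rdiv_lt_0_compat; [lra|].
  apply pow_lt; lra.
Qed.

(** * The ground state argument *)

Lemma sq_sub_ge (a b r s : R) :
  0 < r -> r * s = 1 -> a ^ 2 * (1 - r) + b ^ 2 * (1 - s) <= (a - b) ^ 2.
Proof.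
  intros Hr Hrs.
  assert (Hs : 0 < s) by nra.
  assert (E : (a - b) ^ 2 - (a ^ 2 * (1 - r) + b ^ 2 * (1 - s))
              = s * (a * r - b) ^ 2).
  { transitivity (a ^ 2 * r * (r * s) - 2 * a * b * (r * s) + b ^ 2 * s);
      [rewrite Hrs|]; ring. }
  pose proof (pow2_ge_0 (a * r - b)).
  nra.
Qed.

(** The two numbers are [u(n)/u(n+1)] and [u(n+1)/u(n)] for [u = sqrt]. *)
Lemma ground_state_ratios (n : nat) :
  (1 <= n)%nat ->
  0 < sqrt (1 - 1 / INR (S n)) /\
  sqrt (1 - 1 / INR (S n)) * sqrt (1 + 1 / INR n) = 1.
Proof.
  intros Hn.
  assert (Hn0 : 0 < INR n) by (apply lt_0_INR; lia).
  rewrite S_INR.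
  replace (1 - 1 / (INR n + 1)) with (INR n / (INR n + 1)) by (field; lra).
  assert (0 < INR n / (INR n + 1)) by (apply Rdiv_lt_0_compat; lra).
  assert (0 < 1 / INR n) by (apply Rdiv_lt_0_compat; lra).
  split; [apply sqrt_lt_R0; assumption|].
  rewrite <- sqrt_mult by lra.
  replace (INR n / (INR n + 1) * (1 + 1 / INR n)) with 1 by (field; lra).
  apply sqrt_1.
Qed.

(** The weight [w (S N)] is assembled from the two differences adjacent to
    [phi (S N)], and only the first of them is in the sum; the last term on the
    left takes back the share of the second one, which is nonpositive.  The
    induction closes only with this term kept. *)
Lemma hardy_partial_sums (phi : nat -> R) (N : nat) :
  phi 0%nat = 0 ->
  sum_n (fun j => w (S j) * phi (S j) ^ 2) N
    + phi (S N) ^ 2 * (sqrt (1 + 1 / INR (S N)) - 1)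
  <= sum_n (fun j => (phi (S j) - phi (S j - 1)%nat) ^ 2) N.
Proof.
  intros H0.
  induction N as [|N IH].
  - rewrite !sum_O, (w_closed_form 1) by lia.
    simpl (1 - 1)%nat; rewrite H0; simpl INR.
    replace (1 - 1 / 1) with 0 by field.
    rewrite sqrt_0; lra.
  - rewrite !sum_Sn; unfold plus; simpl (AbelianMonoid.plus _ _).
    rewrite (w_closed_form (S (S N))) by lia.
    replace (S (S N) - 1)%nat with (S N) by lia.
    destruct (ground_state_ratios (S N) ltac:(lia)) as [Hr Hrs].
    pose proof (sq_sub_ge (phi (S (S N))) (phi (S N)) _ _ Hr Hrs).
    simpl in *; lra.
Qed.

Lemma sum_weighted_le_sum_differences (phi : nat -> R) (N : nat) :
  phi 0%nat = 0 ->
  sum_n (fun j => w (S j) * phi (S j) ^ 2) N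
  <= sum_n (fun j => (phi (S j) - phi (S j - 1)%nat) ^ 2) N.
Proof.
  intros H0.
  pose proof (hardy_partial_sums phi N H0).
  assert (1 <= sqrt (1 + 1 / INR (S N))).
  { rewrite <- sqrt_1 at 1; apply sqrt_le_1_alt.
    assert (0 < 1 / INR (S N)) by (apply Rdiv_lt_0_compat; [lra | apply lt_0_INR; lia]).
    lra. }
  pose proof (pow2_ge_0 (phi (S N))).
  nra.
Qed.

(** * Finitely supported sequences *)

Lemma finitely_supported_eventually_0 (phi : nat -> R) :
  finitely_supported phi ->
  exists N, forall n, (N <= n)%nat -> phi n = 0.
Proof.
  intros [l Hl].
  exists (S (list_max l)); intros n Hn.
  destruct (Req_dec (phi n) 0) as [E|E]; [exact E|].
  pose proof (proj1 (list_max_le l (list_max l)) (le_n _)) as Hmax.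
  rewrite Forall_forall in Hmax.
  specialize (Hmax n (Hl n E)); lia.
Qed.

Lemma ex_series_eventually_0 (a : nat -> R) (N : nat) :
  (forall n, (N <= n)%nat -> a n = 0) -> ex_series a.
Proof.
  intros Ha.
  apply (ex_series_incr_n a N).
  exists 0.
  apply (is_lim_seq_ext (fun _ => 0) _ 0); [|apply is_lim_seq_const].
  intros n; symmetry.
  rewrite (sum_n_ext _ (fun _ => 0)), sum_n_const by (intros k; apply Ha; lia).
  ring.
Qed.

Lemma Series_le_of_partial_sums (a b : nat -> R) :
  ex_series a -> ex_series b ->
  (forall N, sum_n a N <= sum_n b N) -> Series a <= Series b.
Proof.
  intros Ha Hb Hab.
  apply (is_lim_seq_le (sum_n a) (sum_n b) (Series a) (Series b) Hab).
  - exact (Series_correct a Ha).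
  - exact (Series_correct b Hb).
Qed.

(** * The improved Hardy inequality *)

Theorem theorem1 :
  (forall phi : nat -> R,
      finitely_supported phi -> phi 0%nat = 0 ->
      ex_series1 (fun n : nat => (phi n - phi (n - 1)%nat) ^ 2) /\
      ex_series1 (fun n : nat => w n * phi n ^ 2) /\
      Series1 (fun n : nat => (phi n - phi (n - 1)%nat) ^ 2)
        >= Series1 (fun n : nat => w n * phi n ^ 2)) /\
  (forall n : nat, (1 <= n)%nat -> 0 < w n) /\
  w 1%nat = 2 - sqrt 2 /\
  (forall n : nat, (2 <= n)%nat ->
      is_series1 (hardy_term n) (w n) /\
      hardy_term n 1%nat = 1 / (4 * INR n ^ 2) /\
      hardy_term n 2%nat = 5 / (64 * INR n ^ 4) /\
      hardy_term n 3%nat = 21 / (512 * INR n ^ 6)) /\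
  (forall n : nat, (1 <= n)%nat -> w n > w_H n).
Proof.
  split; [|split; [exact w_pos|split; [reflexivity|split; [|exact w_gt_w_H]]]].
  - intros phi Hphi H0.
    destruct (finitely_supported_eventually_0 phi Hphi) as [N HN].
    assert (HD : ex_series1 (fun n => (phi n - phi (n - 1)%nat) ^ 2)).
    { apply (ex_series_eventually_0 _ N); intros n Hn.
      rewrite !HN by lia; ring. }
    assert (HW : ex_series1 (fun n => w n * phi n ^ 2)).
    { apply (ex_series_eventually_0 _ N); intros n Hn.
      rewrite HN by lia; ring. }
    split; [exact HD|split; [exact HW|]].
    apply Rle_ge, Series_le_of_partial_sums; [exact HW | exact HD|].
    intros M; apply sum_weighted_le_sum_differences, H0.
  - intros n Hn.
    assert (Hn0 : INR n <> 0) by (apply not_0_INR; lia).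
    split; [rewrite w_closed_form by lia; apply is_series1_hardy_term, Hn|].
    destruct sqrt_coef_2_4_6 as [E2 [E4 E6]].
    repeat split; rewrite hardy_term_sqrt_coef by lia.
    + rewrite E2; field; exact Hn0.
    + rewrite E4; field; exact Hn0.
    + rewrite E6; field; exact Hn0.
Qed.
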